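(* Let $(\mathcal{C},\otimes,1)$ be a pre-braided monoidal category such that the unit $1$ is a left $\otimes$-generator for $\mathcal{C}$; assume moreover that $\mathcal{C}$ has coequalizers and that every object of $\mathcal{C}$ is coflat. Suppose $f_1:R_1\to S_1$ and $f_2:R_2\to S_2$ are algebra morphisms in $\mathcal{C}$ such that $f_1^*=-\otimes_{R_1}S_1$ and $f_2^*=-\otimes_{R_2}S_2$ are semiseparable (resp., separable, naturally full). Then $(f_1\otimes f_2)^*=-\otimes_{R_1\otimes R_2}(S_1\otimes S_2):\mathcal{C}_{R_1\otimes R_2}\to\mathcal{C}_{S_1\otimes S_2}$ is also semiseparable (resp., separable, naturally full).
   Context: Associativity and unit constraints are suppressed. A pre-braided monoidal category is a monoidal category with a natural transformation $c_{X,Y}:X\otimes Y\to Y\otimes X$, not necessarily invertible, satisfying the axioms of a braiding other than invertibility: $c_{X,Y\otimes Z}=(\mathrm{Id}_Y\otimes c_{X,Z})(c_{X,Y}\otimes\mathrm{Id}_Z)$, $c_{X\otimes Y,Z}=(c_{X,Z}\otimes\mathrm{Id}_Y)(\mathrm{Id}_X\otimes c_{Y,Z})$, and $c_{1,X}$, $c_{X,1}$ are the canonical identifications. For algebras $A,B$ in $\mathcal{C}$, $A\otimes B$ is an algebra with multiplication $(m_A\otimes m_B)(\mathrm{Id}_A\otimes c_{B,A}\otimes\mathrm{Id}_B)$ and unit $u_A\otimes u_B$; tensor products of algebra morphisms are algebra morphisms. For an algebra $A$, $\mathcal{C}_A$ (resp. ${}_A\mathcal{C}$) is the category of right (resp.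 left) $A$-modules in $\mathcal{C}$. An object $X$ is coflat if both $X\otimes-$ and $-\otimes X$ preserve coequalizers. For $M\in\mathcal{C}_A$ with action $\nu$ and $X\in{}_A\mathcal{C}$ with action $\mu$, $q^A_{M,X}:M\otimes X\to M\otimes_A X$ is the coequalizer of $\nu\otimes\mathrm{Id}_X$ and $\mathrm{Id}_M\otimes\mu$. For an algebra morphism $f:R\to S$, $S$ is a left $R$-module via $m_S(f\otimes\mathrm{Id}_S)$, and the induction functor $f^*=-\otimes_R S:\mathcal{C}_R\to\mathcal{C}_S$ sends $X$ to $X\otimes_R S$ with right $S$-action induced by $m_S$, and $h:X\to Y$ to the unique morphism $h\otimes_R S$ with $(h\otimes_R S)q^R_{X,S}=q^R_{Y,S}(h\otimes\mathrm{Id}_S)$. An object $P$ is a left $\otimes$-generator of $\mathcal{C}$ if for any morphisms $f,g:Y\otimes Z\to W$ with $f(\varepsilon\otimes\mathrm{Id}_Z)=g(\varepsilon\otimes\mathrm{Id}_Z)$ for all $\varepsilon:P\to Y$, one has $f=g$. A functor $F:\mathcal{A}\to\mathcal{B}$ induces the natural transformation $\mathcal{F}:\mathrm{Hom}_{\mathcal{A}}(-,-)\to\mathrm{Hom}_{\mathcal{B}}(F-,F-)$, $f\mapsto F(f)$. $F$ is separable (resp. naturally full, semiseparable) if there is a natural transformation $\mathcal{P}:\mathrm{Hom}_{\mathcal{B}}(F-,F-)\to\mathrm{Hom}_{\mathcal{A}}(-,-)$ with $\mathcal{P}\circ\mathcal{F}=\mathrm{Id}$ (resp. $\mathcal{F}\circ\mathcal{P}=\mathrm{Id}$,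 $\mathcal{F}\circ\mathcal{P}\circ\mathcal{F}=\mathcal{F}$). *)

(* Defs.v *)
From Stdlib Require Import ProofIrrelevance ClassicalEpsilon.

Set Implicit Arguments.
Unset Strict Implicit.
Unset Printing Implicit Defensive.

Declare Scope cat_scope.
Delimit Scope cat_scope with cat.
Local Open Scope cat_scope.

Reserved Notation "X --> Y" (at level 90, Y at next level, no associativity).
Reserved Notation "g ∘ f" (at level 40, left associativity).
Reserved Notation "X ⊗ Y" (at level 35, right associativity).
Reserved Notation "f ⊗₁ g" (at level 35, right associativity).

Record Category := {
  Ob :> Type;
  Hom : Ob -> Ob -> Type;
  idm : forall X, Hom X X;
  comp : forall X Y Z, Hom Y Z -> Hom X Y -> Hom X Z;
  comp_idl : forall X Y (f : Hom X Y), comp (idm Y) f = f;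
  comp_idr : forall X Y (f : Hom X Y), comp f (idm X) = f;
  comp_assoc : forall X Y Z T (h : Hom Z T) (g : Hom Y Z) (f : Hom X Y),
    comp h (comp g f) = comp (comp h g) f
}.

Arguments Hom {c} _ _.
Arguments idm {c} X.
Arguments comp {c X Y Z} _ _.
Arguments comp_idl {c X Y f}.
Arguments comp_idr {c X Y f}.
Arguments comp_assoc {c X Y Z T h g f}.

Notation "X --> Y" := (Hom X Y) : cat_scope.
Notation "g ∘ f" := (comp g f) : cat_scope.

Record Functor (A B : Category) := {
  fob :> A -> B;
  fmap : forall X Y : A, (X --> Y) -> (fob X --> fob Y);
  fmap_id : forall X : A, fmap (idm X) = idm (fob X);
  fmap_comp : forall (X Y Z : A) (g : Y --> Z) (f : X --> Y),
    fmap (g ∘ f) = fmap g ∘ fmap f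
}.

Arguments fmap {A B} F {X Y} _ : rename.

(** [Hom_B(F-, F-) -> Hom_A(-, -)], natural in both variables. *)
Record HomTransformation (A B : Category) (F : Functor A B) := {
  ht_map :> forall X Y : A, (F X --> F Y) -> (X --> Y);
  ht_natural : forall (X X' Y Y' : A) (h : X' --> X) (k : Y --> Y')
      (g : F X --> F Y),
    ht_map (fmap F k ∘ g ∘ fmap F h) = k ∘ ht_map g ∘ h
}.

Arguments ht_map {A B F} _ {X Y} _.

Definition separable (A B : Category) (F : Functor A B) : Prop :=
  exists P : HomTransformation F,
    forall (X Y : A) (f : X --> Y), P _ _ (fmap F f) = f.

Definition naturally_full (A B : Category) (F : Functor A B) : Prop :=
  exists P : HomTransformation F,
    forall (X Y : A) (g : F X --> F Y), fmap F (P _ _ g) = g.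

Definition semiseparable (A B : Category) (F : Functor A B) : Prop :=
  exists P : HomTransformation F,
    forall (X Y : A) (f : X --> Y), fmap F (P _ _ (fmap F f)) = fmap F f.

Definition is_coequalizer (C : Category) (X Y Q : C) (f g : X --> Y)
    (q : Y --> Q) : Prop :=
  q ∘ f = q ∘ g /\
  forall (Z : C) (h : Y --> Z), h ∘ f = h ∘ g -> exists! u : Q --> Z, u ∘ q = h.

Record Coequalizer (C : Category) (X Y : C) (f g : X --> Y) := {
  coeq_ob : C;
  coeq_map : Y --> coeq_ob;
  coeq_spec : is_coequalizer f g coeq_map
}.

(** A choice of coequalizer for each parallel pair; [- ⊗_A -] is defined
    relative to it. *)
Definition has_coequalizers (C : Category) : Type :=
  forall (X Y : C) (f g : X --> Y), Coequalizer f g.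

Definition preserves_coequalizers (A B : Category) (F : Functor A B) : Prop :=
  forall (X Y Q : A) (f g : X --> Y) (q : Y --> Q),
    is_coequalizer f g q -> is_coequalizer (fmap F f) (fmap F g) (fmap F q).

Section CoequalizerTheory.
Variables (C : Category) (X Y Q : C) (f g : X --> Y) (q : Y --> Q).
Hypothesis q_coeq : is_coequalizer f g q.

Lemma is_coequalizer_epi (Z : C) (u v : Q --> Z) : u ∘ q = v ∘ q -> u = v.
Proof.
intros E. destruct q_coeq as [e ump].
destruct (ump Z (v ∘ q)) as [w [_ uw]].
- now rewrite <- !comp_assoc, e.
- now rewrite <- (uw u E), <- (uw v eq_refl).
Qed.

Definition coeq_desc (Z : C) (h : Y --> Z) (e : h ∘ f = h ∘ g) : Q --> Z :=
  proj1_sig (constructive_indefinite_description _ (proj2 q_coeq Z h e)).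

Lemma coeq_descE (Z : C) (h : Y --> Z) (e : h ∘ f = h ∘ g) :
  coeq_desc e ∘ q = h.
Proof.
exact (proj1 (proj2_sig
  (constructive_indefinite_description _ (proj2 q_coeq Z h e)))).
Qed.

End CoequalizerTheory.

Record MonoidalCategory := {
  mon_cat :> Category;
  tens : mon_cat -> mon_cat -> mon_cat;
  tensm : forall X X' Y Y' : mon_cat,
    (X --> X') -> (Y --> Y') -> (tens X Y --> tens X' Y');
  munit : mon_cat;
  tensm_id : forall X Y : mon_cat, tensm (idm X) (idm Y) = idm (tens X Y);
  tensm_comp : forall (X X' X'' Y Y' Y'' : mon_cat)
      (f' : X' --> X'') (f : X --> X') (g' : Y' --> Y'') (g : Y --> Y'),
    tensm (f' ∘ f) (g' ∘ g) = tensm f' g' ∘ tensm f g;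
  assoc : forall X Y Z : mon_cat, tens (tens X Y) Z --> tens X (tens Y Z);
  assoc_inv : forall X Y Z : mon_cat, tens X (tens Y Z) --> tens (tens X Y) Z;
  lunit : forall X : mon_cat, tens munit X --> X;
  lunit_inv : forall X : mon_cat, X --> tens munit X;
  runit : forall X : mon_cat, tens X munit --> X;
  runit_inv : forall X : mon_cat, X --> tens X munit;
  assocK : forall X Y Z, assoc_inv X Y Z ∘ assoc X Y Z = idm _;
  assoc_invK : forall X Y Z, assoc X Y Z ∘ assoc_inv X Y Z = idm _;
  lunitK : forall X, lunit_inv X ∘ lunit X = idm _;
  lunit_invK : forall X, lunit X ∘ lunit_inv X = idm _;
  runitK : forall X, runit_inv X ∘ runit X = idm _;
  runit_invK : forall X, runit X ∘ runit_inv X = idm _;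
  assoc_natural : forall (X X' Y Y' Z Z' : mon_cat)
      (f : X --> X') (g : Y --> Y') (h : Z --> Z'),
    assoc X' Y' Z' ∘ tensm (tensm f g) h = tensm f (tensm g h) ∘ assoc X Y Z;
  lunit_natural : forall (X Y : mon_cat) (f : X --> Y),
    lunit Y ∘ tensm (idm munit) f = f ∘ lunit X;
  runit_natural : forall (X Y : mon_cat) (f : X --> Y),
    runit Y ∘ tensm f (idm munit) = f ∘ runit X;
  pentagon : forall X Y Z T : mon_cat,
    tensm (idm X) (assoc Y Z T) ∘ (assoc X (tens Y Z) T ∘
      tensm (assoc X Y Z) (idm T)) =
    assoc X Y (tens Z T) ∘ assoc (tens X Y) Z T;
  triangle : forall X Y : mon_cat,
    tensm (idm X) (lunit Y) ∘ assoc X munit Y = tensm (runit X) (idm Y)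
}.

Arguments tens {m} _ _.
Arguments tensm {m X X' Y Y'} _ _.
Arguments munit {m}.
Arguments tensm_id {m X Y}.
Arguments tensm_comp {m X X' X'' Y Y' Y'' f' f g' g}.
Arguments assoc {m X Y Z}.
Arguments assoc_inv {m X Y Z}.
Arguments lunit {m} X.
Arguments lunit_inv {m} X.
Arguments runit {m} X.
Arguments runit_inv {m} X.
Arguments assocK {m X Y Z}.
Arguments assoc_invK {m X Y Z}.
Arguments lunitK {m X}.
Arguments lunit_invK {m X}.
Arguments runitK {m X}.
Arguments runit_invK {m X}.
Arguments assoc_natural {m X X' Y Y' Z Z' f g h}.
Arguments lunit_natural {m X Y f}.
Arguments runit_natural {m X Y f}.
Arguments pentagon {m X Y Z T}.
Arguments triangle {m X Y}.

Notation "X ⊗ Y" := (tens X Y) : cat_scope.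
Notation "f ⊗₁ g" := (tensm f g) : cat_scope.

Definition left_tensor_generator (M : MonoidalCategory) (P : M) : Prop :=
  forall (Y Z W : M) (f g : Y ⊗ Z --> W),
    (forall ε : P --> Y, f ∘ (ε ⊗₁ idm Z) = g ∘ (ε ⊗₁ idm Z)) -> f = g.

Lemma reassoc (C : Category) (X Y Z : C) (a : Y --> Z) (b : X --> Y)
    (c : X --> Z) (e : a ∘ b = c) (T : C) (k : T --> X) :
  a ∘ (b ∘ k) = c ∘ k.
Proof. now rewrite comp_assoc, e. Qed.

Lemma reassoc3 (C : Category) (X Y Y' Z : C) (a : Y' --> Z) (b : Y --> Y')
    (b' : X --> Y) (c : X --> Z) (e : a ∘ (b ∘ b') = c) (T : C) (k : T --> X) :
  a ∘ (b ∘ (b' ∘ k)) = c ∘ k.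
Proof. now rewrite <- e, !comp_assoc. Qed.

Arguments reassoc {C X Y Z a b c} e {T k}.
Arguments reassoc3 {C X Y Y' Z a b b' c} e {T k}.

(** [rw e] (resp. [rwr e]) rewrites with [e] from left to right (resp. right to
    left) modulo associativity of composition, leaving
    composites associated to the right. *)
Ltac rassoc := rewrite <- ?comp_assoc.
Tactic Notation "rw" uconstr(e) :=
  rassoc; first [ rewrite (reassoc3 e) | rewrite (reassoc e) | rewrite e ];
  rassoc.
Tactic Notation "rwr" uconstr(e) :=
  rassoc;
  first [ rewrite (reassoc3 (eq_sym e)) | rewrite (reassoc (eq_sym e))
        | rewrite <- e ];
  rassoc.

Section MonoidalTheory.
Context {M : MonoidalCategory}.
Implicit Types X Y Z W : M.

Lemma tensm_merge {X X' X'' Y Y' Y'' : M} {f' : X' --> X''} {f : X --> X'}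
    {g' : Y' --> Y''} {g : Y --> Y'} :
  (f' ⊗₁ g') ∘ (f ⊗₁ g) = (f' ∘ f) ⊗₁ (g' ∘ g).
Proof. symmetry; apply tensm_comp. Qed.

Lemma tensm_split {X X' Y Y' : M} (f : X --> X') (g : Y --> Y') :
  f ⊗₁ g = (f ⊗₁ idm Y') ∘ (idm X ⊗₁ g).
Proof. now rewrite tensm_merge, comp_idl, comp_idr. Qed.

Lemma tensm_exchange {X X' Y Y' : M} {f : X --> X'} {g : Y --> Y'} :
  (f ⊗₁ idm Y') ∘ (idm X ⊗₁ g) = (idm X' ⊗₁ g) ∘ (f ⊗₁ idm Y).
Proof. now rewrite !tensm_merge, !comp_idl, !comp_idr. Qed.

Lemma tensm_compl {W X Y Z} {g : Y --> Z} {f : X --> Y} :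
  (idm W ⊗₁ g) ∘ (idm W ⊗₁ f) = idm W ⊗₁ (g ∘ f).
Proof. now rewrite tensm_merge, comp_idl. Qed.

Lemma tensm_compr {W X Y Z} {g : Y --> Z} {f : X --> Y} :
  (g ⊗₁ idm W) ∘ (f ⊗₁ idm W) = (g ∘ f) ⊗₁ idm W.
Proof. now rewrite tensm_merge, comp_idl. Qed.

Definition tensor_left (X : M) : Functor M M := {|
  fob := fun Y => X ⊗ Y;
  fmap := fun Y Z f => idm X ⊗₁ f;
  fmap_id := fun Y => tensm_id;
  fmap_comp := fun Y Z T g f => eq_sym tensm_compl
|}.

Definition tensor_right (X : M) : Functor M M := {|
  fob := fun Y => Y ⊗ X;
  fmap := fun Y Z f => f ⊗₁ idm X;
  fmap_id := fun Y => tensm_id;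
  fmap_comp := fun Y Z T g f => eq_sym tensm_compr
|}.

Definition coflat (X : M) : Prop :=
  preserves_coequalizers (tensor_left X) /\
  preserves_coequalizers (tensor_right X).

Lemma tensm_unitl_inj {X Y} (f g : X --> Y) :
  idm munit ⊗₁ f = idm munit ⊗₁ g -> f = g.
Proof.
intros E.
rewrite <- (comp_idr (f := f)), <- (comp_idr (f := g)), <- lunit_invK.
now rewrite !comp_assoc, <- !lunit_natural, E.
Qed.

Lemma tensm_unitr_inj {X Y} (f g : X --> Y) :
  f ⊗₁ idm munit = g ⊗₁ idm munit -> f = g.
Proof.
intros E.
rewrite <- (comp_idr (f := f)), <- (comp_idr (f := g)), <- runit_invK.
now rewrite !comp_assoc, <- !runit_natural, E.
Qed.

Lemma assoc_epi {X Y Z W} (f g : X ⊗ (Y ⊗ Z) --> W) :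
  f ∘ assoc = g ∘ assoc -> f = g.
Proof.
intros E.
rewrite <- (comp_idr (f := f)), <- (comp_idr (f := g)), <- assoc_invK.
now rewrite !comp_assoc, E.
Qed.

Lemma assoc_mono {X Y Z W} (f g : W --> (X ⊗ Y) ⊗ Z) :
  assoc ∘ f = assoc ∘ g -> f = g.
Proof.
intros E.
rewrite <- (comp_idl (f := f)), <- (comp_idl (f := g)), <- assocK.
now rewrite <- !comp_assoc, E.
Qed.

Lemma assoc_inv_natural {X X' Y Y' Z Z'} {f : X --> X'} {g : Y --> Y'}
    {h : Z --> Z'} :
  assoc_inv ∘ (f ⊗₁ (g ⊗₁ h)) = ((f ⊗₁ g) ⊗₁ h) ∘ assoc_inv.
Proof.
apply assoc_epi. rassoc. rwr assoc_natural. rw assocK. rw assocK.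
now rewrite comp_idl, comp_idr.
Qed.

Lemma lunit_tens {X Y} : lunit (X ⊗ Y) ∘ assoc = lunit X ⊗₁ idm Y.
Proof.
apply tensm_unitl_inj. apply assoc_epi.
assert (epi : forall W (f g : (munit ⊗ (munit ⊗ X)) ⊗ Y --> W),
  f ∘ (assoc ⊗₁ idm Y) = g ∘ (assoc ⊗₁ idm Y) -> f = g).
{ intros W f g E.
  rewrite <- (comp_idr (f := f)), <- (comp_idr (f := g)), <- tensm_id,
    <- assoc_invK, <- tensm_compr.
  now rewrite !comp_assoc, E. }
apply epi. rassoc. rewrite <- tensm_compl. rw pentagon. rw triangle.
rewrite <- (tensm_id (X := X) (Y := Y)). rwr assoc_natural.
rw tensm_compr. rw triangle. now rewrite assoc_natural.
Qed.

Lemma runit_tens {X Y} : (idm X ⊗₁ runit Y) ∘ assoc = runit (X ⊗ Y).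
Proof.
apply tensm_unitr_inj, assoc_mono. rewrite <- tensm_compr.
rw assoc_natural. rewrite <- triangle, <- tensm_compl. rassoc.
rw pentagon. rwr assoc_natural. now rewrite tensm_id, triangle.
Qed.

Lemma lunit_runit : lunit (munit (m := M)) = runit munit.
Proof.
apply tensm_unitr_inj. rewrite <- lunit_tens, <- triangle. f_equal.
rewrite <- (comp_idl (f := lunit _)), <- lunitK.
rassoc. rewrite <- lunit_natural. rw lunitK. now rewrite comp_idl.
Qed.

End MonoidalTheory.

Record PreBraidedCategory := {
  pb_mon :> MonoidalCategory;
  braid : forall X Y : pb_mon, X ⊗ Y --> Y ⊗ X;
  braid_natural : forall (X X' Y Y' : pb_mon) (f : X --> X') (g : Y --> Y'),
    braid X' Y' ∘ (f ⊗₁ g) = (g ⊗₁ f) ∘ braid X Y;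
  braid_tensr : forall X Y Z : pb_mon,
    braid X (Y ⊗ Z) =
    assoc_inv ∘ (idm Y ⊗₁ braid X Z) ∘ assoc ∘ (braid X Y ⊗₁ idm Z) ∘ assoc_inv;
  braid_tensl : forall X Y Z : pb_mon,
    braid (X ⊗ Y) Z =
    assoc ∘ (braid X Z ⊗₁ idm Y) ∘ assoc_inv ∘ (idm X ⊗₁ braid Y Z) ∘ assoc;
  braid_unitl : forall X : pb_mon, braid munit X = runit_inv X ∘ lunit X;
  braid_unitr : forall X : pb_mon, braid X munit = lunit_inv X ∘ runit X
}.

Arguments braid {p X Y}.
Arguments braid_natural {p X X' Y Y' f g}.
Arguments braid_tensr {p X Y Z}.
Arguments braid_tensl {p X Y Z}.
Arguments braid_unitl {p X}.
Arguments braid_unitr {p X}.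

Record Algebra (M : MonoidalCategory) := {
  alg_ob :> M;
  alg_mul : alg_ob ⊗ alg_ob --> alg_ob;
  alg_unit : munit --> alg_ob;
  alg_mulA : alg_mul ∘ (alg_mul ⊗₁ idm _) =
             alg_mul ∘ ((idm _ ⊗₁ alg_mul) ∘ assoc);
  alg_mul1l : alg_mul ∘ (alg_unit ⊗₁ idm _) = lunit _;
  alg_mul1r : alg_mul ∘ (idm _ ⊗₁ alg_unit) = runit _
}.

Arguments alg_mul {M} A : rename.
Arguments alg_unit {M} A : rename.
Arguments alg_mulA {M A} : rename.
Arguments alg_mul1l {M A} : rename.
Arguments alg_mul1r {M A} : rename.

Record AlgebraMorphism (M : MonoidalCategory) (A B : Algebra M) := {
  alg_map :> A --> B;
  alg_map_mul : alg_map ∘ alg_mul A = alg_mul B ∘ (alg_map ⊗₁ alg_map);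
  alg_map_unit : alg_map ∘ alg_unit A = alg_unit B
}.

Arguments alg_map {M A B} _.
Arguments alg_map_mul {M A B f} : rename.
Arguments alg_map_unit {M A B f} : rename.

Section TensorAlgebra.
Context {C : PreBraidedCategory}.
Implicit Types X Y Z W : C.
Implicit Types A B : Algebra C.

(** The braiding and the multiplication of an algebra, acting on the first two
    factors of a product associated to the right. *)
Definition swap X Y W : X ⊗ (Y ⊗ W) --> Y ⊗ (X ⊗ W) :=
  assoc ∘ (braid ⊗₁ idm W) ∘ assoc_inv.

Definition mulw A W : A ⊗ (A ⊗ W) --> A ⊗ W :=
  (alg_mul A ⊗₁ idm W) ∘ assoc_inv.

(** [(m_A ⊗ m_B) (Id_A ⊗ c_{B,A} ⊗ Id_B)]. *)
Definition tensor_mul A B : (A ⊗ B) ⊗ (A ⊗ B) --> A ⊗ B :=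
  (alg_mul A ⊗₁ alg_mul B) ∘ assoc_inv ∘ (idm A ⊗₁ swap B A B) ∘ assoc.

Definition tensor_unit A B : munit --> A ⊗ B :=
  (alg_unit A ⊗₁ alg_unit B) ∘ lunit_inv munit.

Lemma pentagon_inv {X Y Z W} :
  (assoc_inv ⊗₁ idm W) ∘ (assoc_inv ∘ (idm X ⊗₁ assoc_inv)) =
  assoc_inv (X := X ⊗ Y) (Y := Z) ∘ assoc_inv.
Proof.
do 2 apply assoc_epi.
rw assocK. rw comp_idl. rw assocK. rwr pentagon. rw tensm_compl.
rewrite assocK, tensm_id. rw comp_idl. rw assocK. rw comp_idl.
rw tensm_compr. now rewrite assocK, tensm_id.
Qed.

Lemma pentagon_move {X Y Z W} :
  assoc ∘ (assoc ⊗₁ idm W) =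
  (idm X ⊗₁ assoc_inv) ∘ (assoc ∘ assoc (X := X ⊗ Y) (Y := Z)).
Proof.
rewrite <- pentagon. rw tensm_compl. now rewrite assocK, tensm_id, comp_idl.
Qed.

Lemma pentagon_move2 {X Y Z W} :
  assoc ∘ (assoc ∘ (assoc_inv ⊗₁ idm W)) =
  (idm X ⊗₁ assoc (X := Y) (Y := Z)) ∘ assoc.
Proof.
rwr pentagon. rw tensm_compr.
now rewrite assoc_invK, tensm_id, comp_idr.
Qed.

Lemma pentagon_move3 {X Y Z W} :
  assoc ∘ (assoc_inv ⊗₁ idm W) =
  assoc_inv ∘ ((idm X ⊗₁ assoc (X := Y) (Y := Z)) ∘ assoc).
Proof. rewrite <- pentagon_move2. rw assocK. now rewrite comp_idl. Qed.

Lemma swap_natural {X X' Y Y' W W' : C} {f : X --> X'} {g : Y --> Y'}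
    {h : W --> W'} :
  swap X' Y' W' ∘ (f ⊗₁ (g ⊗₁ h)) = (g ⊗₁ (f ⊗₁ h)) ∘ swap X Y W.
Proof.
unfold swap. rw assoc_inv_natural. rw tensm_merge. rewrite braid_natural.
rw comp_idl. rwr assoc_natural. do 2 f_equal.
rw tensm_merge. now rewrite comp_idr.
Qed.

Lemma mulw_natural {A W W'} {h : W --> W'} :
  mulw A W' ∘ (idm A ⊗₁ (idm A ⊗₁ h)) = (idm A ⊗₁ h) ∘ mulw A W.
Proof.
unfold mulw. rw assoc_inv_natural. rewrite tensm_id. rw tensm_exchange.
reflexivity.
Qed.

Lemma mulwA {A W} :
  mulw A W ∘ mulw A (A ⊗ W) = mulw A W ∘ (idm A ⊗₁ mulw A W).
Proof.
unfold mulw. rewrite <- tensm_compl. rassoc.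
rewrite <- (tensm_id (X := A) (Y := W)).
rw assoc_inv_natural. rw assoc_inv_natural. rwr pentagon_inv.
rw tensm_compr. rw tensm_compr. rw tensm_compr. do 2 f_equal.
rassoc. rw alg_mulA. rw assoc_invK. now rewrite comp_idr.
Qed.

Lemma swap_tensr {X Y Z W} :
  (idm Y ⊗₁ swap X Z W) ∘ swap X Y (Z ⊗ W) =
  assoc ∘ (swap X (Y ⊗ Z) W ∘ (idm X ⊗₁ assoc_inv)).
Proof.
unfold swap. rewrite braid_tensr, <- !tensm_compr, <- !tensm_compl. rassoc.
rw pentagon_inv. rw pentagon_move2. rw assoc_natural. rw pentagon_move.
rw assoc_natural. rw assoc_invK. now rewrite comp_idl, tensm_id.
Qed.

Lemma swap_tensl {X Y Z W} :
  swap X Z (Y ⊗ W) ∘ (idm X ⊗₁ swap Y Z W) =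
  (idm Z ⊗₁ assoc) ∘ (swap (X ⊗ Y) Z W ∘ assoc_inv).
Proof.
unfold swap. rewrite braid_tensl, <- !tensm_compr, <- !tensm_compl. rassoc.
rw pentagon. rw assoc_natural. rw pentagon_move3. rw assoc_natural.
rw pentagon_move. rewrite (reassoc assoc_invK). rewrite comp_idl.
rw assoc_invK. now rewrite comp_idr, tensm_id.
Qed.

Lemma swap_mulw {X A W} :
  swap X A W ∘ (idm X ⊗₁ mulw A W) =
  mulw A (X ⊗ W) ∘ ((idm A ⊗₁ swap X A W) ∘ swap X A (A ⊗ W)).
Proof.
rewrite swap_tensr. unfold mulw. rassoc. rw assocK. rw comp_idl.
rewrite <- tensm_compl, <- (tensm_id (X := X) (Y := W)). rassoc.
now rwr swap_natural.
Qed.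

Lemma mulw_swap {A Z W} :
  swap A Z W ∘ mulw A (Z ⊗ W) =
  (idm Z ⊗₁ mulw A W) ∘ (swap A Z (A ⊗ W) ∘ (idm A ⊗₁ swap A Z W)).
Proof.
rewrite swap_tensl. unfold mulw. rewrite <- tensm_compl.
rassoc. rw tensm_compl. rw tensm_compl. rw assocK. rewrite comp_idr.
now rwr swap_natural; rewrite tensm_id.
Qed.

Lemma mul_mulw {A} :
  alg_mul A ∘ mulw A A = alg_mul A ∘ (idm A ⊗₁ alg_mul A).
Proof.
unfold mulw. rw alg_mulA. rewrite assoc_invK. now rewrite comp_idr.
Qed.

Lemma assoc_mulw {A X W} :
  assoc ∘ (mulw A X ⊗₁ idm W) =
  mulw A (X ⊗ W) ∘ ((idm A ⊗₁ assoc) ∘ assoc).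
Proof.
unfold mulw. rewrite <- tensm_compr. rw assoc_natural. rewrite pentagon_move3.
rassoc. now rewrite tensm_id.
Qed.

Lemma assoc_swap {X Y Z W} :
  assoc ∘ (swap X Y Z ⊗₁ idm W) =
  (idm Y ⊗₁ assoc_inv) ∘ (swap X Y (Z ⊗ W) ∘ ((idm X ⊗₁ assoc) ∘ assoc)).
Proof.
unfold swap. rewrite <- !tensm_compr. rassoc. rw pentagon_move.
rw assoc_natural. rw pentagon_move3. now rewrite tensm_id.
Qed.

(** [tensor_mul] without its first tensor factor, and the same with a
    spectator. *)
Definition tact A B : B ⊗ (A ⊗ B) --> A ⊗ B :=
  (idm A ⊗₁ alg_mul B) ∘ swap B A B.
Definition tactw A B W : B ⊗ (A ⊗ (B ⊗ W)) --> A ⊗ (B ⊗ W) :=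
  (idm A ⊗₁ mulw B W) ∘ swap B A (B ⊗ W).

Lemma tensor_mulE {A B} :
  tensor_mul A B = mulw A B ∘ ((idm A ⊗₁ tact A B) ∘ assoc).
Proof.
unfold tensor_mul, tact. rewrite (tensm_split (alg_mul A)), <- tensm_compl.
rewrite <- (tensm_id (X := A) (Y := A)). rassoc. rwr assoc_inv_natural.
unfold mulw. now rassoc.
Qed.

Lemma assoc_act {A B W} :
  assoc ∘ (tact A B ⊗₁ idm W) =
  tactw A B W ∘ ((idm B ⊗₁ assoc) ∘ assoc).
Proof.
unfold tact, tactw, mulw. rewrite <- tensm_compr, <- tensm_compl.
rw assoc_natural. now rw assoc_swap.
Qed.

Lemma assoc_tensor_mul {A B W} :
  assoc ∘ (tensor_mul A B ⊗₁ idm W) =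
  mulw A (B ⊗ W) ∘ ((idm A ⊗₁ tactw A B W) ∘
    (assoc ∘ ((idm (A ⊗ B) ⊗₁ assoc) ∘ assoc))).
Proof.
rewrite tensor_mulE, <- !tensm_compr. rw assoc_mulw. rw assoc_natural.
rw tensm_compl. rewrite assoc_act, <- !tensm_compl. rw pentagon.
rewrite <- (tensm_id (X := A) (Y := B)). now rw assoc_natural.
Qed.

Lemma act_mul {A B} :
  mulw A B ∘ ((idm A ⊗₁ tact A B) ∘ tactw A B (A ⊗ B)) =
  tact A B ∘ (idm B ⊗₁ (mulw A B ∘ (idm A ⊗₁ tact A B))).
Proof.
unfold tact, tactw. rewrite <- !tensm_compl. rassoc.
rw swap_mulw. rwr mulw_natural. f_equal.
rw swap_natural. rw swap_natural.
rw (tensm_compl (f := mulw _ _)). rewrite mulw_swap, <- !tensm_compl.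
rw (tensm_compl (g := swap _ _ _) (f := _ ⊗₁ _ ⊗₁ alg_mul _)).
rewrite swap_natural, <- !tensm_compl. rassoc.
rw (tensm_compl (g := _ ⊗₁ alg_mul _) (f := _ ⊗₁ mulw _ _)).
rewrite tensm_compl, mul_mulw. now rewrite <- !tensm_compl; rassoc.
Qed.

Lemma tensor_mulA {A B} :
  tensor_mul A B ∘ (tensor_mul A B ⊗₁ idm _) =
  tensor_mul A B ∘ ((idm _ ⊗₁ tensor_mul A B) ∘ assoc).
Proof.
rewrite (tensor_mulE (A := A) (B := B)) at 1. rw assoc_tensor_mul.
rewrite tensor_mulE, <- !tensm_compl. rassoc.
rewrite <- (tensm_id (X := A) (Y := B)). rw assoc_natural. rw assoc_natural.
do 2 rw assoc_natural.
rwr mulw_natural. rw mulwA. f_equal.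
pose proof (f_equal (tensm (idm A)) (act_mul (A := A) (B := B))) as E.
rewrite <- !tensm_compl in E. now rw E.
Qed.

Lemma act_unit {A B} :
  tact A B ∘ (alg_unit B ⊗₁ idm (A ⊗ B)) = lunit (A ⊗ B).
Proof.
unfold tact, swap. rewrite <- (tensm_id (X := A) (Y := B)).
rw assoc_inv_natural. rw tensm_compr. rewrite braid_natural.
rewrite <- tensm_compr. rw assoc_natural. rw tensm_compl.
rewrite alg_mul1l. rw triangle. rw tensm_compr. rewrite braid_unitl.
rw runit_invK. rewrite comp_idl, <- lunit_tens. rw assoc_invK.
now rewrite comp_idr.
Qed.

Lemma mulw_unit {A W} :
  mulw A W ∘ (alg_unit A ⊗₁ idm (A ⊗ W)) = lunit (A ⊗ W).
Proof.
unfold mulw. rewrite <- (tensm_id (X := A) (Y := W)).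
rw assoc_inv_natural. rw tensm_compr. rewrite alg_mul1l, <- lunit_tens.
rw assoc_invK. now rewrite comp_idr.
Qed.

Lemma tensor_mul1l {A B} :
  tensor_mul A B ∘ (tensor_unit A B ⊗₁ idm _) = lunit (A ⊗ B).
Proof.
rewrite tensor_mulE. unfold tensor_unit. rewrite <- tensm_compr.
rw assoc_natural. rw tensm_merge.
rewrite comp_idl, (tensm_split (alg_unit A)). rw act_unit. rw mulw_unit.
rw triangle. rw tensm_compr.
now rewrite <- lunit_runit, lunit_invK, tensm_id, comp_idr.
Qed.

Lemma act_unitr {A B} :
  tact A B ∘ (idm B ⊗₁ (alg_unit A ⊗₁ alg_unit B)) =
  (alg_unit A ⊗₁ idm B) ∘ (lunit_inv B ∘ (runit B ∘ (idm B ⊗₁ runit munit))).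
Proof.
unfold tact. rw swap_natural. rw tensm_merge.
rewrite alg_mul1r, comp_idl, (tensm_split (alg_unit A)).
unfold swap. rassoc. rewrite (reassoc runit_tens). rassoc.
rw runit_natural. rewrite braid_unitr, <- runit_tens. rw assoc_invK.
now rewrite comp_idr.
Qed.

Lemma mulw_unitr {A W} :
  mulw A W ∘ ((idm A ⊗₁ (alg_unit A ⊗₁ idm W)) ∘ (idm A ⊗₁ lunit_inv W)) =
  idm (A ⊗ W).
Proof.
unfold mulw. rw assoc_inv_natural. rw tensm_compr.
rewrite alg_mul1r, <- triangle. rw assoc_invK. rw comp_idl.
now rewrite tensm_compl, lunit_invK, tensm_id.
Qed.

Lemma tensor_mul1r {A B} :
  tensor_mul A B ∘ (idm _ ⊗₁ tensor_unit A B) = runit (A ⊗ B).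
Proof.
rewrite tensor_mulE. unfold tensor_unit.
rewrite <- tensm_compl, <- (tensm_id (X := A) (Y := B)). rw assoc_natural.
rewrite (tensm_id (X := A) (Y := B)). rw tensm_compl.
rewrite act_unitr, <- !tensm_compl. rassoc. rw mulw_unitr.
rewrite comp_idl, <- runit_tens. f_equal. rwr assoc_natural.
rewrite tensm_id, tensm_compl.
now rewrite <- lunit_runit, lunit_invK, tensm_id, comp_idr.
Qed.

Definition tensor_alg A B : Algebra C := {|
  alg_ob := A ⊗ B;
  alg_mul := tensor_mul A B;
  alg_unit := tensor_unit A B;
  alg_mulA := tensor_mulA;
  alg_mul1l := tensor_mul1l;
  alg_mul1r := tensor_mul1r
|}.

Section Morphism.
Context {A A' B B' : Algebra C}.
Variables (f : AlgebraMorphism A A') (g : AlgebraMorphism B B').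

Lemma tensor_map_mul :
  (f ⊗₁ g) ∘ alg_mul (tensor_alg A B) =
  alg_mul (tensor_alg A' B') ∘ ((f ⊗₁ g) ⊗₁ (f ⊗₁ g)).
Proof.
cbn. unfold tensor_mul. rw tensm_merge. rewrite !alg_map_mul.
rw assoc_natural. rewrite tensm_comp. rassoc. f_equal.
rw (tensm_merge (f := alg_map f)). rewrite swap_natural, comp_idl.
rewrite <- (comp_idr (f := alg_map f)) at 3. rewrite tensm_comp.
rw assoc_inv_natural. reflexivity.
Qed.

Lemma tensor_map_unit :
  (f ⊗₁ g) ∘ alg_unit (tensor_alg A B) = alg_unit (tensor_alg A' B').
Proof.
cbn. unfold tensor_unit. rw tensm_merge. now rewrite !alg_map_unit.
Qed.

Definition tensor_map :
    AlgebraMorphism (tensor_alg A B) (tensor_alg A' B') :=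
  @Build_AlgebraMorphism C (tensor_alg A B) (tensor_alg A' B') (f ⊗₁ g)
    tensor_map_mul tensor_map_unit.

End Morphism.
End TensorAlgebra.

Section Modules.
Context {M : MonoidalCategory}.

Record RightModule (A : Algebra M) := {
  rm_ob :> M;
  rm_act : rm_ob ⊗ A --> rm_ob;
  rm_actA : rm_act ∘ (rm_act ⊗₁ idm A) =
            rm_act ∘ ((idm rm_ob ⊗₁ alg_mul A) ∘ assoc);
  rm_act1 : rm_act ∘ (idm rm_ob ⊗₁ alg_unit A) = runit rm_ob
}.

Record LeftModule (A : Algebra M) := {
  lm_ob :> M;
  lm_act : A ⊗ lm_ob --> lm_ob;
  lm_actA : lm_act ∘ (alg_mul A ⊗₁ idm lm_ob) =
            lm_act ∘ ((idm A ⊗₁ lm_act) ∘ assoc);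
  lm_act1 : lm_act ∘ (alg_unit A ⊗₁ idm lm_ob) = lunit lm_ob
}.

Record RightModuleMorphism (A : Algebra M) (X Y : RightModule A) := {
  rm_map :> X --> Y;
  rm_map_act : rm_map ∘ rm_act X = rm_act Y ∘ (rm_map ⊗₁ idm A)
}.

Lemma rm_map_inj (A : Algebra M) (X Y : RightModule A)
    (h k : RightModuleMorphism X Y) : rm_map h = rm_map k -> h = k.
Proof.
destruct h as [h eh], k as [k ek]; cbn; intros E; destruct E.
now rewrite (proof_irrelevance _ eh ek).
Qed.

Section Category.
Variable A : Algebra M.

Lemma rm_id_act (X : RightModule A) :
  idm X ∘ rm_act X = rm_act X ∘ (idm X ⊗₁ idm A).
Proof. now rewrite tensm_id, comp_idl, comp_idr. Qed.

Lemma rm_comp_act (X Y Z : RightModule A) (k : RightModuleMorphism Y Z)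
    (h : RightModuleMorphism X Y) :
  (k ∘ h) ∘ rm_act X = rm_act Z ∘ ((k ∘ h) ⊗₁ idm A).
Proof.
rewrite <- tensm_compr. rw (rm_map_act h). now rw (rm_map_act k).
Qed.

Definition right_modules : Category.
Proof.
refine {|
  Ob := RightModule A;
  Hom := @RightModuleMorphism A;
  idm := fun X => {| rm_map := idm X; rm_map_act := rm_id_act X |};
  comp := fun X Y Z k h =>
    {| rm_map := k ∘ h; rm_map_act := rm_comp_act k h |}
|}; intros; apply rm_map_inj; cbn.
- apply comp_idl.
- apply comp_idr.
- apply comp_assoc.
Defined.

End Category.
End Modules.

Arguments rm_act {M A} X : rename.
Arguments rm_actA {M A X} : rename.
Arguments rm_act1 {M A X} : rename.
Arguments lm_act {M A} X : rename.
Arguments lm_actA {M A X} : rename.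
Arguments lm_act1 {M A X} : rename.
Arguments rm_map {M A X Y} _.
Arguments rm_map_act {M A X Y h} : rename.
Arguments right_modules {M} A.

Section Induction.
Context {M : MonoidalCategory}.
Variable coeq : has_coequalizers M.

Section RelativeTensor.
Context {A : Algebra M}.
Variables (X : RightModule A) (Y : LeftModule A).

Definition rel_tensor_coeq :=
  coeq (rm_act X ⊗₁ idm Y) ((idm X ⊗₁ lm_act Y) ∘ assoc).

Definition rel_tensor : M := coeq_ob rel_tensor_coeq.

(** [q^A_{X,Y}]. *)
Definition rel_proj : X ⊗ Y --> rel_tensor := coeq_map rel_tensor_coeq.

Lemma rel_proj_coeq :
  is_coequalizer (rm_act X ⊗₁ idm Y) ((idm X ⊗₁ lm_act Y) ∘ assoc) rel_proj.
Proof. exact (coeq_spec rel_tensor_coeq). Qed.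

End RelativeTensor.

Section RelativeTensorMap.
Context {A : Algebra M} {X X' : RightModule A}.
Variables (Y : LeftModule A) (h : RightModuleMorphism X X').

Lemma rel_map_compat :
  (rel_proj X' Y ∘ (h ⊗₁ idm Y)) ∘ (rm_act X ⊗₁ idm Y) =
  (rel_proj X' Y ∘ (h ⊗₁ idm Y)) ∘ ((idm X ⊗₁ lm_act Y) ∘ assoc).
Proof.
rw tensm_compr. rewrite rm_map_act, <- tensm_compr. rassoc.
rewrite (reassoc (proj1 (rel_proj_coeq X' Y))). rassoc.
rw tensm_exchange. rw assoc_natural. now rewrite tensm_id.
Qed.

Definition rel_map : rel_tensor X Y --> rel_tensor X' Y :=
  coeq_desc (rel_proj_coeq X Y) rel_map_compat.

Lemma rel_mapE :
  rel_map ∘ rel_proj X Y = rel_proj X' Y ∘ (h ⊗₁ idm Y).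
Proof. apply coeq_descE. Qed.

End RelativeTensorMap.

Section RelativeTensorFunctor.
Context {A : Algebra M}.
Variable Y : LeftModule A.

Lemma rel_map_id (X : RightModule A) :
  rel_map Y (idm (X : right_modules A)) = idm (rel_tensor X Y).
Proof.
apply (is_coequalizer_epi (rel_proj_coeq X Y)).
rewrite rel_mapE. cbn. now rewrite tensm_id, comp_idl, comp_idr.
Qed.

Lemma rel_map_comp (X X' X'' : right_modules A) (k : X' --> X'')
    (h : X --> X') :
  rel_map Y (k ∘ h) = rel_map Y k ∘ rel_map Y h.
Proof.
apply (is_coequalizer_epi (rel_proj_coeq X Y)).
rewrite rel_mapE. rw (rel_mapE _ _). rw (rel_mapE _ _).
cbn. now rewrite tensm_compr.
Qed.

End RelativeTensorFunctor.

Hypothesis coflatM : forall X : M, coflat X.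

Section Algebras.
Context {R S : Algebra M}.
Variable f : AlgebraMorphism R S.

Lemma restr_actA :
  (alg_mul S ∘ (f ⊗₁ idm S)) ∘ (alg_mul R ⊗₁ idm S) =
  (alg_mul S ∘ (f ⊗₁ idm S)) ∘
    ((idm R ⊗₁ (alg_mul S ∘ (f ⊗₁ idm S))) ∘ assoc).
Proof.
rw tensm_compr. rewrite alg_map_mul, <- tensm_compr. rw alg_mulA.
rewrite (tensm_split (alg_map f) (alg_map f)), <- tensm_compr,
  <- !tensm_compl. rassoc.
rw assoc_natural. rw assoc_natural. rewrite tensm_id. now rwr tensm_exchange.
Qed.

Lemma restr_act1 :
  (alg_mul S ∘ (f ⊗₁ idm S)) ∘ (alg_unit R ⊗₁ idm S) = lunit S.
Proof. rw tensm_compr. now rewrite alg_map_unit, alg_mul1l. Qed.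

Definition restr_left : LeftModule R :=
  {| lm_act := alg_mul S ∘ (f ⊗₁ idm S);
     lm_actA := restr_actA;
     lm_act1 := restr_act1 |}.

Lemma restr_act_mul :
  alg_mul S ∘ ((alg_mul S ∘ (f ⊗₁ idm S)) ⊗₁ idm S) =
  (alg_mul S ∘ (f ⊗₁ idm S)) ∘ ((idm R ⊗₁ alg_mul S) ∘ assoc).
Proof.
rewrite <- tensm_compr. rw alg_mulA. rw assoc_natural.
rewrite tensm_id. now rwr tensm_exchange.
Qed.

Section Object.
Variable X : RightModule R.
Let q := rel_proj X restr_left.

Lemma rel_proj_tensr :
  is_coequalizer ((rm_act X ⊗₁ idm S) ⊗₁ idm S)
    (((idm X ⊗₁ lm_act restr_left) ∘ assoc) ⊗₁ idm S) (q ⊗₁ idm S).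
Proof. exact (proj2 (coflatM S) _ _ _ _ _ _ (rel_proj_coeq X restr_left)). Qed.

Lemma rel_proj_epi (Z : M) (u v : rel_tensor X restr_left --> Z) :
  u ∘ q = v ∘ q -> u = v.
Proof. exact (is_coequalizer_epi (rel_proj_coeq X restr_left) (v := v)). Qed.

Lemma rel_proj_tensr_epi (Y Z : M)
    (u v : rel_tensor X restr_left ⊗ Y --> Z) :
  u ∘ (q ⊗₁ idm Y) = v ∘ (q ⊗₁ idm Y) -> u = v.
Proof.
exact (is_coequalizer_epi
  (proj2 (coflatM Y) _ _ _ _ _ _ (rel_proj_coeq X restr_left)) (v := v)).
Qed.

Lemma induced_act_compat :
  (q ∘ ((idm X ⊗₁ alg_mul S) ∘ assoc)) ∘ ((rm_act X ⊗₁ idm S) ⊗₁ idm S) =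
  (q ∘ ((idm X ⊗₁ alg_mul S) ∘ assoc)) ∘
    (((idm X ⊗₁ lm_act restr_left) ∘ assoc) ⊗₁ idm S).
Proof.
rw assoc_natural. rewrite tensm_id. rwr tensm_exchange.
unfold q. rewrite (reassoc (proj1 (rel_proj_coeq X restr_left))).
cbn. rewrite <- (tensm_compr (f := assoc)). rw assoc_natural.
rw (tensm_compl (g := alg_mul S)). rewrite restr_act_mul, <- !tensm_compl.
rw pentagon. rewrite <- (tensm_id (X := X) (Y := R)). now rw assoc_natural.
Qed.

Definition induced_act :
    rel_tensor X restr_left ⊗ S --> rel_tensor X restr_left :=
  coeq_desc rel_proj_tensr induced_act_compat.

Lemma induced_actE :
  induced_act ∘ (q ⊗₁ idm S) = q ∘ ((idm X ⊗₁ alg_mul S) ∘ assoc).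
Proof. apply coeq_descE. Qed.

Lemma induced_actA :
  induced_act ∘ (induced_act ⊗₁ idm S) =
  induced_act ∘ ((idm _ ⊗₁ alg_mul S) ∘ assoc).
Proof.
assert (epi : forall (Z : M) (u v : (rel_tensor X restr_left ⊗ S) ⊗ S --> Z),
  u ∘ ((q ⊗₁ idm S) ⊗₁ idm S) = v ∘ ((q ⊗₁ idm S) ⊗₁ idm S) -> u = v).
{ intros Z u v. exact (is_coequalizer_epi
    (proj2 (coflatM S) _ _ _ _ _ _ rel_proj_tensr) (v := v)). }
apply epi. rw tensm_compr. rewrite induced_actE, <- tensm_compr.
rw induced_actE. rw assoc_natural. rewrite tensm_id. rwr tensm_exchange.
rw induced_actE. f_equal. cbn.
rewrite <- tensm_compr. rw assoc_natural.
rw (tensm_compl (f := alg_mul S ⊗₁ _)). rewrite alg_mulA, <- !tensm_compl. rw pentagon.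
rewrite <- (tensm_id (X := X) (Y := S)). now rw assoc_natural.
Qed.

Lemma induced_act1 :
  induced_act ∘ (idm _ ⊗₁ alg_unit S) = runit _.
Proof.
apply rel_proj_tensr_epi. rwr tensm_exchange. rw induced_actE.
rewrite runit_natural. cbn. rewrite <- (tensm_id (X := X) (Y := S)).
rw assoc_natural. rw tensm_compl. now rewrite alg_mul1r, runit_tens.
Qed.

Definition induced_module : RightModule S :=
  {| rm_ob := rel_tensor X restr_left;
     rm_act := induced_act;
     rm_actA := induced_actA;
     rm_act1 := induced_act1 |}.

End Object.

Lemma induced_map_act (X Y : RightModule R) (h : RightModuleMorphism X Y) :
  rel_map restr_left h ∘ induced_act X =
  induced_act Y ∘ (rel_map restr_left h ⊗₁ idm S).
Proof.
apply rel_proj_tensr_epi. rw (induced_actE _). rw (rel_mapE _ _). rw tensm_compr.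
rewrite rel_mapE, <- tensm_compr. rw (induced_actE _). rw assoc_natural.
rewrite tensm_id. now rw tensm_exchange.
Qed.

(** [f^* = - ⊗_R S]. *)
Definition induction : Functor (right_modules R) (right_modules S).
Proof.
refine (@Build_Functor (right_modules R) (right_modules S) induced_module
  (fun X Y (h : RightModuleMorphism X Y) =>
    @Build_RightModuleMorphism M S (induced_module X) (induced_module Y)
      (rel_map restr_left h) (induced_map_act h)) _ _).
- intros X. apply rm_map_inj, rel_map_id.
- intros X Y Z k h. apply rm_map_inj, rel_map_comp.
Defined.

End Algebras.
End Induction.

Arguments induction {M} coeq coflatM {R S} f.

(* Main.v *)
(** Induction along [f : R -> S] is left adjoint to restriction of scalars, so a
    natural transformation [Hom (f^* -, f^* -) -> Hom (-, -)] amounts to a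
    natural contraction [X ⊗_R S -> X] of [R]-modules. Evaluated
    at [X = R], it gives a map [E : S -> R] of right [R]-modules; naturality with
    respect to left multiplications by points [1 -> R] makes [E] left [R]-linear,
    because [1] is a left [⊗]-generator. Conversely an [R]-bimodule map [E] gives
    the contraction [x ⊗ s |-> x E(s)]. Semiseparability, separability and
    natural fullness become [f E u_S = u_S], [E u_S = u_R] and [f E = Id_S],
    and all of these pass from [E1], [E2] to [E1 ⊗ E2]. *)

Require Import Defs.

Set Implicit Arguments.
Unset Strict Implicit.
Unset Printing Implicit Defensive.
Local Open Scope cat_scope.

(** * Naturality in each variable separately *)

Lemma ht_natural_l (A B : Category) (F : Functor A B)
    (P : HomTransformation F) (X Y Y' : A) (k : Y --> Y') (g : F X --> F Y) :
  P _ _ (fmap F k ∘ g) = k ∘ P _ _ g.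
Proof.
rewrite <- (comp_idr (f := k ∘ _)), <- (ht_natural P).
now rewrite fmap_id, comp_idr.
Qed.

Lemma ht_natural_r (A B : Category) (F : Functor A B)
    (P : HomTransformation F) (X X' Y : A) (h : X' --> X) (g : F X --> F Y) :
  P _ _ (g ∘ fmap F h) = P _ _ g ∘ h.
Proof.
rewrite <- (comp_idl (f := P _ _ g)), <- (ht_natural P).
now rewrite fmap_id, comp_idl.
Qed.

(** * Restriction of scalars and left multiplication by points *)

Section RestrictionOfScalars.
Context {M : MonoidalCategory}.

Lemma lunit_inv_natural {X Y : M} {h : X --> Y} :
  lunit_inv Y ∘ h = (idm munit ⊗₁ h) ∘ lunit_inv X.
Proof.
rewrite <- (comp_idr (f := h)) at 1. rewrite <- (lunit_invK (X := X)).
rassoc. rwr lunit_natural. rw lunitK. now rewrite comp_idl.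
Qed.

Lemma runit_inv_natural {X Y : M} {h : X --> Y} :
  runit_inv Y ∘ h = (h ⊗₁ idm munit) ∘ runit_inv X.
Proof.
rewrite <- (comp_idr (f := h)) at 1. rewrite <- (runit_invK (X := X)).
rassoc. rwr runit_natural. rw runitK. now rewrite comp_idl.
Qed.

Lemma lunit_inv_tens {X Y : M} :
  assoc ∘ (lunit_inv X ⊗₁ idm Y) = lunit_inv (X ⊗ Y).
Proof.
rewrite <- (comp_idl (f := assoc ∘ _)), <- lunitK. rassoc.
rewrite (reassoc lunit_tens). rw tensm_compr.
now rewrite lunit_invK, tensm_id, comp_idr.
Qed.

Definition regular_module (A : Algebra M) : RightModule A :=
  {| rm_ob := A; rm_act := alg_mul A;
     rm_actA := alg_mulA; rm_act1 := alg_mul1r |}.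

Lemma left_mul_act (A : Algebra M) (a : munit --> A) :
  (alg_mul A ∘ (a ⊗₁ idm A) ∘ lunit_inv A) ∘ alg_mul A =
  alg_mul A ∘ ((alg_mul A ∘ (a ⊗₁ idm A) ∘ lunit_inv A) ⊗₁ idm A).
Proof.
rewrite <- !tensm_compr. rw alg_mulA. rw assoc_natural.
rewrite tensm_id. rwr tensm_exchange. do 2 f_equal.
now rewrite lunit_inv_tens, lunit_inv_natural.
Qed.

(** The map [x |-> a x]. Since it is right linear, a transformation on right modules is natural with
    respect to it, and this is how left linearity is detected. *)
Definition left_mul (A : Algebra M) (a : munit --> A) :
    @Hom (right_modules A) (regular_module A) (regular_module A) :=
  @Build_RightModuleMorphism _ _ (regular_module A) (regular_module A)
    (alg_mul A ∘ (a ⊗₁ idm A) ∘ lunit_inv A) (left_mul_act a).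

Context {R S : Algebra M}.
Variable f : AlgebraMorphism R S.

Section Object.
Variable N : RightModule S.

Lemma restricted_actA :
  (rm_act N ∘ (idm N ⊗₁ f)) ∘ ((rm_act N ∘ (idm N ⊗₁ f)) ⊗₁ idm R) =
  (rm_act N ∘ (idm N ⊗₁ f)) ∘ ((idm N ⊗₁ alg_mul R) ∘ assoc).
Proof.
rw tensm_compl. rewrite alg_map_mul, <- tensm_compl, <- tensm_compr. rassoc.
rwr assoc_natural. rwr (rm_actA (X := N)).
rw tensm_merge. rw tensm_merge. rw tensm_merge.
now rewrite !comp_idl, !comp_idr.
Qed.

Lemma restricted_act1 :
  (rm_act N ∘ (idm N ⊗₁ f)) ∘ (idm N ⊗₁ alg_unit R) = runit N.
Proof. rw tensm_compl. now rewrite alg_map_unit, rm_act1. Qed.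

Definition restricted_module : RightModule R :=
  {| rm_ob := N; rm_act := rm_act N ∘ (idm N ⊗₁ f);
     rm_actA := restricted_actA; rm_act1 := restricted_act1 |}.

End Object.

Lemma restricted_map_act (N N' : RightModule S)
    (h : RightModuleMorphism N N') :
  h ∘ rm_act (restricted_module N) =
  rm_act (restricted_module N') ∘ (h ⊗₁ idm R).
Proof. cbn. rw (rm_map_act (h := h)). now rw tensm_exchange. Qed.

Definition restriction : Functor (right_modules S) (right_modules R).
Proof.
refine (@Build_Functor (right_modules S) (right_modules R) restricted_module
  (fun N N' (h : RightModuleMorphism N N') =>
    @Build_RightModuleMorphism M R (restricted_module N)
      (restricted_module N') h (restricted_map_act h)) _ _).
- intros N. now apply rm_map_inj.
- intros N N' N'' k h. now apply rm_map_inj.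
Defined.

Lemma alg_map_act :
  f ∘ rm_act (regular_module R) =
  rm_act (restricted_module (regular_module S)) ∘ (f ⊗₁ idm R).
Proof.
cbn. rw tensm_merge. now rewrite comp_idl, comp_idr, alg_map_mul.
Qed.

Definition alg_module_map :
    @Hom (right_modules R) (regular_module R)
      (restriction (regular_module S)) :=
  @Build_RightModuleMorphism _ _ (regular_module R)
    (restricted_module (regular_module S)) f alg_map_act.

Lemma alg_map_left_mul (a : munit --> R) :
  f ∘ rm_map (left_mul a) = rm_map (left_mul (alg_map f ∘ a)) ∘ f.
Proof.
cbn. rw alg_map_mul. rw tensm_merge. rewrite comp_idr.
rewrite lunit_inv_natural. rw tensm_merge. now rewrite comp_idl, comp_idr.
Qed.

End RestrictionOfScalars.

(** * The adjunction between induction and restriction *)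

Section InductionRestriction.
Context {M : MonoidalCategory}.
Variables (coeq : has_coequalizers M) (coflatM : forall X : M, coflat X).
Context {R S : Algebra M}.
Variable f : AlgebraMorphism R S.

Notation ind := (induction coeq coflatM f).
Notation res := (restriction f).
Notation Rmod := (regular_module R).
Notation Smod := (regular_module S).
Notation proj X := (rel_proj coeq X (restr_left f)).

(** This form of [rel_mapE] keeps [fmap ind] folded, so that functoriality still applies around
    it. *)
Lemma induction_mapE (X Y : RightModule R) (h : RightModuleMorphism X Y) :
  rm_map (fmap ind h) ∘ proj X = proj Y ∘ (h ⊗₁ idm S).
Proof. exact (rel_mapE coeq (restr_left f) h). Qed.

Section Unit.
Variable X : RightModule R.

Definition ind_unit_map : X --> rel_tensor coeq X (restr_left f) :=
  proj X ∘ ((idm X ⊗₁ alg_unit S) ∘ runit_inv X).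

(** Balancing over [R] gives [x r ⊗ 1 = x ⊗ f(r) 1]. Besides the linearity of the unit, this
    computes the unit after any contraction [x ⊗ s |-> x E(s)]. *)
Lemma ind_unit_map_act : ind_unit_map ∘ rm_act X = proj X ∘ (idm X ⊗₁ f).
Proof.
unfold ind_unit_map. rassoc. rewrite runit_inv_natural. rwr tensm_exchange.
rewrite (reassoc (proj1 (rel_proj_coeq coeq X (restr_left f)))). cbn. f_equal.
rewrite <- (tensm_id (X := X) (Y := R)). rw assoc_natural.
rw tensm_compl.
assert (E : alg_mul S ∘ ((f ⊗₁ idm S) ∘ (idm R ⊗₁ alg_unit S)) = f ∘ runit R).
{ rw tensm_exchange. rw alg_mul1r. apply runit_natural. }
rewrite E, <- tensm_compl. rassoc. rewrite (reassoc runit_tens). rassoc.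
now rewrite runit_invK, comp_idr.
Qed.

(** In elements, [(x ⊗ 1) s = x ⊗ s]; this is the computation behind [ind_triangle]. *)
Lemma induced_act_unit_map :
  induced_act coeq coflatM f X ∘ (ind_unit_map ⊗₁ idm S) = proj X.
Proof.
unfold ind_unit_map. rewrite <- !tensm_compr. rw (induced_actE coeq coflatM f X).
rw assoc_natural. cbn. rw tensm_compl. rewrite alg_mul1l. rw triangle.
rw tensm_compr. now rewrite runit_invK, tensm_id, comp_idr.
Qed.

Lemma ind_unit_act :
  ind_unit_map ∘ rm_act X =
  rm_act (restricted_module f (induced_module coeq coflatM f X)) ∘
    (ind_unit_map ⊗₁ idm R).
Proof.
rewrite ind_unit_map_act. cbn. rwr tensm_exchange.
now rw induced_act_unit_map.
Qed.

Definition ind_unit : @Hom (right_modules R) X (res (ind X)) :=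
  @Build_RightModuleMorphism _ _ X
    (restricted_module f (induced_module coeq coflatM f X))
    ind_unit_map ind_unit_act.

End Unit.

Lemma ind_unit_natural (X Y : right_modules R) (h : X --> Y) :
  fmap res (fmap ind h) ∘ ind_unit X = ind_unit Y ∘ h.
Proof.
apply rm_map_inj. cbn. unfold ind_unit_map. rw (rel_mapE coeq _ h).
rw runit_inv_natural. now rw tensm_exchange.
Qed.

Section Counit.
Variable N : RightModule S.

Lemma ind_counit_compat :
  rm_act N ∘ (rm_act (restricted_module f N) ⊗₁ idm S) =
  rm_act N ∘ ((idm N ⊗₁ lm_act (restr_left f)) ∘ assoc).
Proof.
cbn. rewrite <- tensm_compr, <- tensm_compl. rw (rm_actA (X := N)).
now rw assoc_natural.
Qed.

Definition ind_counit_map :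
    rel_tensor coeq (restricted_module f N) (restr_left f) --> N :=
  coeq_desc (rel_proj_coeq coeq (restricted_module f N) (restr_left f))
    ind_counit_compat.

Lemma ind_counit_mapE :
  ind_counit_map ∘ proj (restricted_module f N) = rm_act N.
Proof. apply coeq_descE. Qed.

Lemma ind_counit_act :
  ind_counit_map ∘
    rm_act (induced_module coeq coflatM f (restricted_module f N)) =
  rm_act N ∘ (ind_counit_map ⊗₁ idm S).
Proof.
apply (rel_proj_tensr_epi coflatM).
rw tensm_compr. rewrite ind_counit_mapE.
change (rm_act (induced_module coeq coflatM f (restricted_module f N)))
  with (induced_act coeq coflatM f (restricted_module f N)).
rw (induced_actE coeq coflatM f (restricted_module f N)). rw ind_counit_mapE.
exact (eq_sym (rm_actA (X := N))).
Qed.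

Definition ind_counit : @Hom (right_modules S) (ind (res N)) N :=
  @Build_RightModuleMorphism _ _
    (induced_module coeq coflatM f (restricted_module f N)) N
    ind_counit_map ind_counit_act.

End Counit.

Lemma ind_counit_natural (N N' : right_modules S) (k : N --> N') :
  ind_counit N' ∘ fmap ind (fmap res k) = k ∘ ind_counit N.
Proof.
apply rm_map_inj. apply (rel_proj_epi (f := f) (coeq := coeq)).
change (ind_counit_map N' ∘ rm_map (fmap ind (fmap res k)) ∘
  proj (restricted_module f N) =
  rm_map k ∘ ind_counit_map N ∘ proj (restricted_module f N)).
rassoc. rewrite ind_counit_mapE.
transitivity (rm_act N' ∘ (rm_map k ⊗₁ idm S));
  [| exact (eq_sym (rm_map_act (h := k)))].
rewrite <- (ind_counit_mapE N').
rassoc. f_equal. exact (induction_mapE (fmap res k)).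
Qed.

Lemma ind_triangle (X : right_modules R) :
  ind_counit (ind X) ∘ fmap ind (ind_unit X) = idm (ind X).
Proof.
apply rm_map_inj. apply (rel_proj_epi (f := f) (coeq := coeq)).
change (ind_counit_map (ind X) ∘ rm_map (fmap ind (ind_unit X)) ∘ proj X =
  idm _ ∘ proj X).
transitivity (ind_counit_map (ind X) ∘
  (proj (restricted_module f (ind X)) ∘ (ind_unit_map X ⊗₁ idm S))).
- rassoc. f_equal. exact (induction_mapE (ind_unit X)).
- rewrite comp_idl, comp_assoc, ind_counit_mapE. apply induced_act_unit_map.
Qed.

Lemma res_triangle (N : right_modules S) :
  fmap res (ind_counit N) ∘ ind_unit (res N) = idm (res N).
Proof.
apply rm_map_inj. cbn. unfold ind_unit_map. rw (ind_counit_mapE _).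
rw (rm_act1 (X := N)). apply runit_invK.
Qed.

(** With [ind_counit_transpose], this says that transposition is bijective. An equality of maps into
    [res N] can therefore be proved after applying [ind], where the assumptions on a transformation
    apply. *)
Lemma ind_unit_transpose (X : right_modules R) (N : right_modules S)
    (h : X --> res N) :
  fmap res (ind_counit N ∘ fmap ind h) ∘ ind_unit X = h.
Proof.
rewrite fmap_comp. rw (ind_unit_natural _). rw (res_triangle _). apply comp_idl.
Qed.

Lemma ind_counit_transpose (X : right_modules R) (N : right_modules S)
    (k : ind X --> N) :
  ind_counit N ∘ fmap ind (fmap res k ∘ ind_unit X) = k.
Proof.
rewrite fmap_comp. rw (ind_counit_natural _). rw (ind_triangle _).
apply comp_idr.
Qed.

(** The isomorphism [R ⊗_R S -> S]. *)
Definition ind_alg : @Hom (right_modules S) (ind Rmod) Smod :=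
  ind_counit Smod ∘ fmap ind (alg_module_map f).

Lemma ind_alg_inv_act :
  (proj Rmod ∘ ((alg_unit R ⊗₁ idm S) ∘ lunit_inv S)) ∘ rm_act Smod =
  rm_act (induced_module coeq coflatM f Rmod) ∘
  ((proj Rmod ∘ ((alg_unit R ⊗₁ idm S) ∘ lunit_inv S)) ⊗₁ idm S).
Proof.
change (rm_act (induced_module coeq coflatM f Rmod))
  with (induced_act coeq coflatM f Rmod).
rewrite <- !tensm_compr. rw (induced_actE coeq coflatM f Rmod).
rw assoc_natural. rewrite tensm_id. rwr tensm_exchange. rewrite lunit_inv_tens.
now rewrite lunit_inv_natural.
Qed.

Definition ind_alg_inv : @Hom (right_modules S) Smod (ind Rmod) :=
  @Build_RightModuleMorphism _ _ Smod (induced_module coeq coflatM f Rmod)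
   (proj Rmod ∘ ((alg_unit R ⊗₁ idm S) ∘ lunit_inv S)) ind_alg_inv_act.

Lemma ind_algE :
  rm_map ind_alg ∘ proj Rmod = alg_mul S ∘ (f ⊗₁ idm S).
Proof.
transitivity (ind_counit_map Smod ∘
  (proj (restricted_module f Smod) ∘ (f ⊗₁ idm S))).
- cbn. rassoc. f_equal. exact (induction_mapE (alg_module_map f)).
- now rewrite comp_assoc, ind_counit_mapE.
Qed.

Lemma ind_algK : ind_alg_inv ∘ ind_alg = idm (ind Rmod).
Proof.
apply rm_map_inj. apply (rel_proj_epi (f := f) (coeq := coeq)).
change (rm_map ind_alg_inv ∘ rm_map ind_alg ∘ proj Rmod =
  idm (rel_tensor coeq Rmod (restr_left f)) ∘ proj Rmod).
rw ind_algE. cbn. rewrite comp_idl. rassoc.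
change (alg_mul S ∘ (f ⊗₁ idm S)) with (lm_act (restr_left f)).
rewrite lunit_inv_natural. rw tensm_exchange.
(* Precomposed with [assoc_inv], the balancing relation moves the scalar back:
   [1 ⊗ f(r) s = 1 r ⊗ s]. *)
pose proof (proj1 (rel_proj_coeq coeq Rmod (restr_left f))) as E.
apply (f_equal (fun k => k ∘ assoc_inv)) in E. revert E. rassoc.
rewrite assoc_invK, comp_idr. cbn. intros E. rwr E.
rewrite <- (tensm_id (X := R) (Y := S)). rw assoc_inv_natural.
rw tensm_compr. rewrite alg_mul1l, <- lunit_tens. rw assoc_invK.
now rewrite comp_idl, lunit_invK, comp_idr.
Qed.

Lemma ind_alg_invK : ind_alg ∘ ind_alg_inv = idm (Smod : right_modules S).
Proof.
apply rm_map_inj.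
change (rm_map ind_alg ∘ (proj Rmod ∘ ((alg_unit R ⊗₁ idm S) ∘ lunit_inv S))
  = idm (S : M)).
rw ind_algE. cbn. rw tensm_compr. rewrite alg_map_unit. rw alg_mul1l.
apply lunit_invK.
Qed.

(** Both sides transpose to [r |-> f(a r) = f(a) f(r)], so naturality of the counit reduces the
    claim to multiplicativity of [f]. *)
Lemma ind_alg_left_mul (a : munit --> R) :
  ind_alg ∘ fmap ind (left_mul a) =
  left_mul (alg_map f ∘ a) ∘ ind_alg.
Proof.
unfold ind_alg. rassoc. rewrite <- fmap_comp, comp_assoc.
rewrite <- (ind_counit_natural (left_mul (alg_map f ∘ a))).
rassoc. rewrite <- fmap_comp. do 2 f_equal.
apply rm_map_inj, alg_map_left_mul.
Qed.

Lemma ind_alg_inv_left_mul (a : munit --> R) :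
  fmap ind (left_mul a) ∘ ind_alg_inv =
  ind_alg_inv ∘ left_mul (alg_map f ∘ a).
Proof.
rewrite <- (comp_idr (f := left_mul (alg_map f ∘ a))), <- ind_alg_invK.
rewrite (comp_assoc (g := ind_alg)), <- ind_alg_left_mul. rassoc.
rewrite (comp_assoc (g := ind_alg)), ind_algK. now rewrite comp_idl.
Qed.

(** * From transformations to bimodule maps *)

Definition bimodule_map (E : S --> R) : Prop :=
  E ∘ (alg_mul S ∘ (f ⊗₁ idm S)) = alg_mul R ∘ (idm R ⊗₁ E) /\
  E ∘ (alg_mul S ∘ (idm S ⊗₁ f)) = alg_mul R ∘ (E ⊗₁ idm R).

Section TransformationToBimoduleMap.
Variable P : HomTransformation ind.

(** The argument of [P] is [s ⊗ t |-> 1 ⊗ s t], the counit followed by the identification of [S]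
    with [R ⊗_R S]. *)
Definition retraction : @Hom (right_modules R) (res Smod) Rmod :=
  P _ _ (ind_alg_inv ∘ ind_counit Smod).

(** Naturality of [P] moves both multiplications inside its argument, where they agree because
    [ind_alg_inv] exchanges multiplication by [f(a)] with induced multiplication by [a]. *)
Lemma retraction_left_mul (a : munit --> R) :
  retraction ∘ fmap res (left_mul (alg_map f ∘ a)) =
  left_mul a ∘ retraction.
Proof.
unfold retraction. rewrite <- ht_natural_r, <- ht_natural_l. f_equal. rassoc.
rewrite ind_counit_natural, !comp_assoc. f_equal.
symmetry. apply ind_alg_inv_left_mul.
Qed.

(** Right linearity is part of being a morphism in [right_modules R]. Left linearity is an equality
    of maps out of [R ⊗ S], so the generator property reduces it to points of [R]. *)
Lemma retraction_bimodule
    (unit_generator : left_tensor_generator (munit (m := M))) :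
  bimodule_map (rm_map retraction).
Proof.
split; [| exact (rm_map_act (h := retraction))].
apply unit_generator. intros a.
pose proof (f_equal rm_map (retraction_left_mul a)) as E. cbn in E.
(* Precomposing with [lunit S] cancels the [lunit_inv] in the definition of [left_mul]. *)
apply (f_equal (fun k => k ∘ lunit S)) in E. revert E. rassoc.
rewrite lunitK, comp_idr. rw lunit_inv_natural. rw lunitK.
rewrite comp_idr, tensm_compr. rw tensm_exchange. easy.
Qed.

(** Moving [f] inside [P] turns the counit into [ind_alg], which cancels against [ind_alg_inv]. *)
Lemma retraction_alg :
  retraction ∘ alg_module_map f =
  P _ _ (fmap ind (idm (Rmod : right_modules R))).
Proof.
unfold retraction. rewrite <- ht_natural_r, <- comp_assoc, fmap_id. f_equal.
apply ind_algK.
Qed.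

Lemma retraction_separable :
  (forall (X Y : right_modules R) (h : X --> Y), P _ _ (fmap ind h) = h) ->
  rm_map retraction ∘ f = idm R.
Proof.
intros H. pose proof retraction_alg as E. rewrite H in E.
exact (f_equal rm_map E).
Qed.

Lemma retraction_semiseparable :
  (forall (X Y : right_modules R) (h : X --> Y),
    fmap ind (P _ _ (fmap ind h)) = fmap ind h) ->
  f ∘ (rm_map retraction ∘ f) = f.
Proof.
intros H.
set (g := alg_module_map f).
enough (E : g ∘ (retraction ∘ g) = g) by exact (f_equal rm_map E).
(* After transposition the inner factor is [fmap ind (P (fmap ind id))], which [H] replaces by
   [fmap ind id]. *)
rewrite <- (ind_unit_transpose (g ∘ (retraction ∘ g))).
rewrite (fmap_comp ind). unfold g at 2 3. rewrite retraction_alg, H.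
rewrite <- fmap_comp, comp_idr. apply ind_unit_transpose.
Qed.

Lemma retraction_naturally_full :
  (forall (X Y : right_modules R) (h : ind X --> ind Y),
    fmap ind (P _ _ h) = h) ->
  f ∘ rm_map retraction = idm S.
Proof.
intros H.
set (g := alg_module_map f).
enough (E : g ∘ retraction = idm (res Smod)) by exact (f_equal rm_map E).
(* By [H], the transpose is [ind_alg ∘ ind_alg_inv ∘ ind_counit Smod], that is, the counit, which
   transposes back to the identity. *)
rewrite <- (ind_unit_transpose (g ∘ retraction)).
rewrite (fmap_comp ind). unfold retraction. rewrite H, !comp_assoc.
change (ind_counit Smod ∘ fmap ind g) with ind_alg.
rewrite ind_alg_invK, comp_idl. apply res_triangle.
Qed.

End TransformationToBimoduleMap.

(** * From bimodule maps to transformations *)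

Section BimoduleMapToTransformation.
Variable E : S --> R.
Hypothesis E_bimodule : bimodule_map E.

Section Object.
Variable X : RightModule R.

(** Left linearity of [E] gives [(x r) E(s) = x E(f(r) s)]. *)
Lemma contraction_compat :
  (rm_act X ∘ (idm X ⊗₁ E)) ∘ (rm_act X ⊗₁ idm S) =
  (rm_act X ∘ (idm X ⊗₁ E)) ∘ ((idm X ⊗₁ lm_act (restr_left f)) ∘ assoc).
Proof.
rwr tensm_exchange. rw (rm_actA (X := X)).
rewrite <- (tensm_id (X := X) (Y := R)). rw assoc_natural. rw tensm_compl.
rw tensm_compl. cbn. now rewrite (proj1 E_bimodule).
Qed.

Definition contraction_map : rel_tensor coeq X (restr_left f) --> X :=
  coeq_desc (rel_proj_coeq coeq X (restr_left f)) contraction_compat.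

Lemma contraction_mapE : contraction_map ∘ proj X = rm_act X ∘ (idm X ⊗₁ E).
Proof. apply coeq_descE. Qed.

(** Right linearity of [E] gives [x E(s f(r)) = (x E(s)) r]. *)
Lemma contraction_act :
  contraction_map ∘
    rm_act (restricted_module f (induced_module coeq coflatM f X)) =
  rm_act X ∘ (contraction_map ⊗₁ idm R).
Proof.
apply (rel_proj_tensr_epi coflatM).
change (rm_act (restricted_module f (induced_module coeq coflatM f X)))
  with (induced_act coeq coflatM f X ∘ (idm _ ⊗₁ f)).
rassoc. rwr tensm_exchange. rw (induced_actE coeq coflatM f X).
rw contraction_mapE. cbn [restr_left lm_ob].
rewrite <- (tensm_id (X := X) (Y := S)).
rw assoc_natural. rw tensm_compr. change (alg_ob S) with (lm_ob (restr_left f)).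
rewrite contraction_mapE, <- tensm_compr. cbn [restr_left lm_ob].
rw (rm_actA (X := X)). rw assoc_natural. rw tensm_compl. rw tensm_compl. rw tensm_compl.
now rewrite (proj2 E_bimodule).
Qed.

Definition contraction : @Hom (right_modules R) (res (ind X)) X :=
  @Build_RightModuleMorphism _ _
    (restricted_module f (induced_module coeq coflatM f X)) X
    contraction_map contraction_act.

Lemma contraction_unit :
  rm_map contraction ∘ rm_map (ind_unit X) =
  rm_act X ∘ ((idm X ⊗₁ (E ∘ alg_unit S)) ∘ runit_inv X).
Proof.
cbn. unfold ind_unit_map. rw contraction_mapE. now rw tensm_compl.
Qed.

Lemma unit_contraction :
  rm_map (ind_unit X) ∘ rm_map contraction ∘ proj X =
  proj X ∘ (idm X ⊗₁ (f ∘ E)).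
Proof.
change (ind_unit_map X ∘ contraction_map ∘ proj X =
  proj X ∘ (idm X ⊗₁ (f ∘ E))).
rassoc. rewrite contraction_mapE. rw (ind_unit_map_act X). now rw tensm_compl.
Qed.

End Object.

Lemma contraction_natural (X Y : right_modules R) (h : X --> Y) :
  contraction Y ∘ fmap res (fmap ind h) = h ∘ contraction X.
Proof.
apply rm_map_inj. apply (rel_proj_epi (f := f) (coeq := coeq)).
change (contraction_map Y ∘ rm_map (fmap ind h) ∘ proj X =
  rm_map h ∘ contraction_map X ∘ proj X).
rassoc. rewrite contraction_mapE.
transitivity (contraction_map Y ∘ (proj Y ∘ (rm_map h ⊗₁ idm S))).
- f_equal. exact (induction_mapE h).
- rewrite comp_assoc, contraction_mapE, comp_assoc.
  rewrite (rm_map_act (h := (h : RightModuleMorphism X Y))). rassoc.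
  now rewrite tensm_exchange.
Qed.

Lemma descent_natural (X X' Y Y' : right_modules R) (h : X' --> X)
    (k : Y --> Y') (g : ind X --> ind Y) :
  contraction Y' ∘ (fmap res (fmap ind k ∘ g ∘ fmap ind h) ∘ ind_unit X') =
  k ∘ (contraction Y ∘ (fmap res g ∘ ind_unit X)) ∘ h.
Proof.
rewrite !fmap_comp. rw (contraction_natural k). now rewrite ind_unit_natural.
Qed.

Definition descent : HomTransformation ind :=
  @Build_HomTransformation _ _ ind
    (fun X Y g => contraction Y ∘ (fmap res g ∘ ind_unit X)) descent_natural.

(** By naturality of the unit, the effect on induced maps is governed by the single endomorphism
    [y |-> y E(1)] of [Y]. *)
Lemma descent_map (X Y : right_modules R) (h : X --> Y) :
  descent _ _ (fmap ind h) = (contraction Y ∘ ind_unit Y) ∘ h.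
Proof.
change (contraction Y ∘ (fmap res (fmap ind h) ∘ ind_unit X) =
  (contraction Y ∘ ind_unit Y) ∘ h).
rewrite ind_unit_natural. apply comp_assoc.
Qed.

Lemma descent_separable :
  E ∘ alg_unit S = alg_unit R ->
  forall (X Y : right_modules R) (h : X --> Y), descent _ _ (fmap ind h) = h.
Proof.
intros H X Y h. rewrite descent_map.
transitivity (idm Y ∘ h); [f_equal | apply comp_idl].
apply rm_map_inj. transitivity (rm_map (contraction Y) ∘ rm_map (ind_unit Y));
  [reflexivity |].
rewrite contraction_unit, H, comp_assoc, rm_act1. apply runit_invK.
Qed.

Lemma descent_semiseparable :
  f ∘ (E ∘ alg_unit S) = alg_unit S ->
  forall (X Y : right_modules R) (h : X --> Y),
    fmap ind (descent _ _ (fmap ind h)) = fmap ind h.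
Proof.
intros H X Y h. rewrite descent_map, fmap_comp.
rewrite <- (comp_idl (f := fmap ind h)) at 2. f_equal.
(* Inserting the triangle identity reduces the claim to [y E(1) ⊗ 1 = y ⊗ f(E(1)) = y ⊗ 1]. *)
rewrite <- (comp_idl (f := fmap ind _)), <- ind_triangle. rassoc.
rewrite <- fmap_comp. do 2 f_equal. apply rm_map_inj.
transitivity (rm_map (ind_unit Y) ∘
  (rm_map (contraction Y) ∘ rm_map (ind_unit Y)));
  [reflexivity |].
rewrite contraction_unit. cbn. rw (ind_unit_map_act Y). rw tensm_compl.
cbn [restr_left lm_ob]. now rewrite H.
Qed.

Lemma descent_naturally_full :
  f ∘ E = idm S ->
  forall (X Y : right_modules R) (g : ind X --> ind Y),
    fmap ind (descent _ _ g) = g.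
Proof.
intros H X Y g.
(* This composite is [y ⊗ s |-> y ⊗ f(E(s))], so [H] makes it trivial; [descent] then acts as
   transposition followed by an inverse of the unit on this side. *)
assert (K : ind_unit Y ∘ contraction Y = idm (res (ind Y))).
{ apply rm_map_inj. apply (rel_proj_epi (f := f) (coeq := coeq)).
  change (rm_map (ind_unit Y) ∘ rm_map (contraction Y) ∘ proj Y =
    idm _ ∘ proj Y).
  now rewrite unit_contraction, H, tensm_id, comp_idl, comp_idr. }
rewrite <- (ind_counit_transpose (fmap ind (descent _ _ g))).
rewrite ind_unit_natural. cbn [descent ht_map].
rewrite (comp_assoc (h := ind_unit Y)), K, comp_idl.
apply ind_counit_transpose.
Qed.

End BimoduleMapToTransformation.

(** * Criteria in terms of a bimodule map *)

Section Characterizations.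
Hypothesis unit_generator : left_tensor_generator (munit (m := M)).

Lemma semiseparable_inductionP :
  semiseparable ind <->
  exists E, bimodule_map E /\ f ∘ (E ∘ alg_unit S) = alg_unit S.
Proof.
split.
- intros [P HP]. exists (rm_map (retraction P)).
  split; [now apply retraction_bimodule |].
  (* Writing the unit of [S] as [f] after the unit of [R] brings the identity [f E f = f] into
     play. *)
  rewrite <- (alg_map_unit (f := f)) at 1. rewrite !comp_assoc.
  rewrite <- (comp_assoc (h := f)), retraction_semiseparable by exact HP.
  apply alg_map_unit.
- intros [E [HE Eu]]. exists (descent HE). now apply descent_semiseparable.
Qed.

Lemma separable_inductionP :
  separable ind <->
  exists E, bimodule_map E /\ E ∘ alg_unit S = alg_unit R.
Proof.
split.
- intros [P HP]. exists (rm_map (retraction P)).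
  split; [now apply retraction_bimodule |].
  rewrite <- (alg_map_unit (f := f)), comp_assoc.
  rewrite retraction_separable by exact HP. apply comp_idl.
- intros [E [HE Eu]]. exists (descent HE). now apply descent_separable.
Qed.

Lemma naturally_full_inductionP :
  naturally_full ind <-> exists E, bimodule_map E /\ f ∘ E = idm S.
Proof.
split.
- intros [P HP]. exists (rm_map (retraction P)).
  split; [now apply retraction_bimodule |].
  now apply retraction_naturally_full.
- intros [E [HE fE]]. exists (descent HE). now apply descent_naturally_full.
Qed.

End Characterizations.
End InductionRestriction.

(** * Tensor products of bimodule maps *)

Lemma middle_swap_natural {C : PreBraidedCategory} {X X' Y Y' Z Z' T T' : C}
    {a : X --> X'} {b : Y --> Y'} {c : Z --> Z'} {d : T --> T'} :
  assoc_inv ∘ ((idm X' ⊗₁ swap Y' Z' T') ∘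
    (assoc ∘ ((a ⊗₁ b) ⊗₁ (c ⊗₁ d)))) =
  ((a ⊗₁ c) ⊗₁ (b ⊗₁ d)) ∘ (assoc_inv ∘ ((idm X ⊗₁ swap Y Z T) ∘ assoc)).
Proof.
rw assoc_natural. rw tensm_merge. rwr assoc_inv_natural. rw tensm_merge.
now rewrite comp_idl, comp_idr, swap_natural.
Qed.

(** Once all maps are moved past the middle swap, each linearity condition is the tensor product of
    the corresponding conditions for [E1] and [E2]. *)
Lemma tensor_bimodule_map (C : PreBraidedCategory) (R1 S1 R2 S2 : Algebra C)
    (f1 : AlgebraMorphism R1 S1) (f2 : AlgebraMorphism R2 S2)
    (E1 : S1 --> R1) (E2 : S2 --> R2) :
  bimodule_map f1 E1 -> bimodule_map f2 E2 ->
  bimodule_map (tensor_map f1 f2) (E1 ⊗₁ E2).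
Proof.
intros [L1 A1] [L2 A2].
split; cbn [tensor_map alg_map tensor_alg alg_mul alg_ob]; unfold tensor_mul;
  (* Identities of products are split first, so that every map entering the swap is a tensor product
     of four maps. *)
  rewrite <- !tensm_id; rassoc; rewrite !middle_swap_natural;
  rw tensm_merge; rw tensm_merge; rw tensm_merge.
- now rewrite L1, L2.
- now rewrite A1, A2.
Qed.

Theorem corollary5p4 (C : PreBraidedCategory)
    (unit_generator : left_tensor_generator (munit (m := C)))
    (coeq : has_coequalizers C)
    (coflatC : forall X : C, coflat X)
    (R1 S1 R2 S2 : Algebra C)
    (f1 : AlgebraMorphism R1 S1) (f2 : AlgebraMorphism R2 S2) :
  (semiseparable (induction coeq coflatC f1) ->
   semiseparable (induction coeq coflatC f2) ->
   semiseparable (induction coeq coflatC (tensor_map f1 f2))) /\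
  (separable (induction coeq coflatC f1) ->
   separable (induction coeq coflatC f2) ->
   separable (induction coeq coflatC (tensor_map f1 f2))) /\
  (naturally_full (induction coeq coflatC f1) ->
   naturally_full (induction coeq coflatC f2) ->
   naturally_full (induction coeq coflatC (tensor_map f1 f2))).
Proof.
rewrite !semiseparable_inductionP, !separable_inductionP,
  !naturally_full_inductionP by exact unit_generator.
(* The remaining condition on the unit or on [f E] holds in each tensor factor. *)
repeat split; intros [E1 [b1 e1]] [E2 [b2 e2]]; exists (E1 ⊗₁ E2);
  (split; [now apply tensor_bimodule_map |]); cbn.
- unfold tensor_unit. rw tensm_merge. rw tensm_merge. now rewrite e1, e2.
- unfold tensor_unit. rw tensm_merge. now rewrite e1, e2.
- rewrite tensm_merge, e1, e2. apply tensm_id.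
Qed.
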